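(* Fix an integer $s\ge 2$. For the Markov chain $\mathrm{MC}_{square}$ on $(1,s)$-square tilings of a rectangular region of size $n\times \log n$, the mixing time $\tau_{mix}$ is bounded by a polynomial in $n$ (i.e. the chain is rapidly mixing).
   Context: A $(1,s)$-tiling of a region $R\subset\mathbb{Z}^2$ is a tiling by axis-parallel $1\times1$ and $s\times s$ squares with integer corners; $\Omega_R$ denotes the set of such tilings. Flips: a central flip replaces an $s\times s$ square by $s^2$ unit squares or vice versa; a horizontal (resp. vertical) flip, inside an $(s+1)\times s$ (resp. $s\times(s+1)$) block, moves an $s\times s$ square by one unit horizontally (resp. vertically), the rest of the block being unit squares. The chain $\mathrm{MC}_{square}$: from the current tiling, choose an inner vertex of $R$ uniformly at random and one of the two flip directions with probability $1/2$, and perform the flip (central or horizontal/vertical) associated to that vertex in that direction if possible, otherwise stay. Its stationary distribution $\pi$ is uniform on $\Omega_R$. For a state $x$, $d_x(t)=\frac12\sum_y|P^t(x,y)-\pi(y)|$, $\tau_{mix}(\varepsilon)=\max_x\min\{t: d_x(t')\le\varepsilon\ \forall t'\ge t\}$ and $\tau_{mix}=\tau_{mix}(1/4)$. *)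

(* Defs.v *)
From HB Require Import structures.
From mathcomp Require Import all_boot all_order all_algebra.
From mathcomp Require Import all_classical all_reals all_analysis.

Set Implicit Arguments.
Unset Strict Implicit.
Unset Printing Implicit Defensive.

Import Order.TTheory GRing.Theory Num.Theory.

Local Open Scope ring_scope.

(* Finite Markov chains given by a transition kernel P x y. *)

Fixpoint kernel_pow (R : realType) (S : finType) (P : S -> S -> R) (t : nat)
    (x y : S) : R :=
  if t is t'.+1 then \sum_(z : S) P x z * kernel_pow P t' z y
  else (x == y)%:R.

Definition uniform_dist (R : realType) (S : finType) (x : S) : R :=
  (#|S|%:R)^-1.

Definition tv_dist (R : realType) (S : finType) (P : S -> S -> R)
    (pi : S -> R) (x : S) (t : nat) : R :=
  2^-1 * \sum_(y : S) `|kernel_pow P t x y - pi y|.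

(* The minimum over t is an infimum in the extended reals: it is attained when
   the set of admissible times is nonempty, and is +oo when no time works. *)
Definition mixing_time_eps (R : realType) (S : finType) (P : S -> S -> R)
    (pi : S -> R) (eps : R) : \bar R :=
  \big[maxe/-oo%E]_(x : S)
    ereal_inf [set (t%:R)%:E | t in
      [set t : nat | forall t' : nat, (t <= t')%N -> tv_dist P pi x t' <= eps]].

Definition mixing_time (R : realType) (S : finType) (P : S -> S -> R)
    (pi : S -> R) : \bar R :=
  mixing_time_eps P pi (4^-1).

(* The region is the rectangle [0, W] x [0, H]; a unit cell is named by its
   lower left corner.  A tile is its lower left cell together with a boolean:
   true for an s x s square, false for a 1 x 1 square. *)

Definition cell (W H : nat) : finType := ('I_W * 'I_H)%type.
Definition tile (W H : nat) : finType := (cell W H * bool)%type.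

Definition block (W H x y w h : nat) : {set cell W H} :=
  [set c : cell W H | (x <= c.1 < x + w)%N && (y <= c.2 < y + h)%N].

Definition side (s : nat) (big : bool) : nat := if big then s else 1%N.

Definition tile_cells (s W H : nat) (t : tile W H) : {set cell W H} :=
  block W H t.1.1 t.1.2 (side s t.2) (side s t.2).

Definition tile_inside (s W H : nat) (t : tile W H) : bool :=
  (t.1.1 + side s t.2 <= W)%N && (t.1.2 + side s t.2 <= H)%N.

Definition is_tiling (s W H : nat) (T : {set tile W H}) : bool :=
  [forall t in T, tile_inside s t] &&
  [forall c : cell W H, #|[set t in T | c \in tile_cells s t]| == 1%N].

Definition tiling (s W H : nat) : finType :=
  {T : {set tile W H} | is_tiling s T}.

(* Two kinds of tilings of a block D: unit squares only, or one s x s square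
   with lower left corner (x, y) and unit squares elsewhere. *)

Definition units (W H : nat) (D : {set cell W H}) : {set tile W H} :=
  [set t : tile W H | (t.1 \in D) && ~~ t.2].

Definition one_square (s W H : nat) (D : {set cell W H}) (x y : nat) :
    {set tile W H} :=
  [set t : tile W H | [&& t.1.1 == x :> nat, t.1.2 == y :> nat & t.2]]
    :|: units (D :\: block W H x y s s).

Definition replaces (W H : nat) (A B T T' : {set tile W H}) : bool :=
  (A \subset T) && (T' == (T :\: A) :|: B).

(* The flips in the block with lower left corner (x, y).  The boolean d is the
   direction: true assembles unit squares into an s x s square (central), moves
   the s x s square right (horizontal) or up (vertical); false is the inverse
   flip. *)

Definition directed_flip (W H : nat) (A B : {set tile W H}) (d : bool)
    (T T' : {set tile W H}) : bool :=
  if d then replaces A B T T' else replaces B A T T'.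

Definition central_flip (s W H x y : nat) (d : bool) (T T' : {set tile W H}) :
    bool :=
  let D := block W H x y s s in
  [&& (x + s <= W)%N, (y + s <= H)%N &
      directed_flip (units D) (one_square s D x y) d T T'].

Definition horizontal_flip (s W H x y : nat) (d : bool)
    (T T' : {set tile W H}) : bool :=
  let D := block W H x y s.+1 s in
  [&& (x + s.+1 <= W)%N, (y + s <= H)%N &
      directed_flip (one_square s D x y) (one_square s D x.+1 y) d T T'].

Definition vertical_flip (s W H x y : nat) (d : bool) (T T' : {set tile W H}) :
    bool :=
  let D := block W H x y s s.+1 in
  [&& (x + s <= W)%N, (y + s.+1 <= H)%N &
      directed_flip (one_square s D x y) (one_square s D x y.+1) d T T'].

(* Lattice points of the rectangle. *)
Definition vertex (W H : nat) : finType := ('I_W.+1 * 'I_H.+1)%type.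

Definition inner_vertices (W H : nat) : {set vertex W H} :=
  [set v : vertex W H | (0 < v.1 < W)%N && (0 < v.2 < H)%N].

Definition vertex_at (W H : nat) (v : vertex W H) (x y : nat) : bool :=
  (v.1 == x :> nat) && (v.2 == y :> nat).

(* A central flip is associated to the centre of its block, and a horizontal or
   vertical flip to the midpoint of the side of the moving square that faces
   the direction of the move; halves are rounded down when s is odd.  For
   2 <= s these are inner vertices, every flip of a given tiling is associated
   to exactly one pair (vertex, direction), and such a pair has at most one
   associated flip.  Hence every possible flip has probability 1 / (2 N), where
   N is the number of inner vertices; any other association with these
   properties yields the same transition kernel. *)
Definition flip_at (s W H : nat) (v : vertex W H) (d : bool)
    (T T' : {set tile W H}) : bool :=
  let front := if d then s else 1%N in
  [exists c : cell W H, let x := nat_of_ord c.1 in let y := nat_of_ord c.2 in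
    [|| vertex_at v (x + s./2) (y + s./2) && central_flip s x y d T T',
        vertex_at v (x + front) (y + s./2) && horizontal_flip s x y d T T' |
        vertex_at v (x + s./2) (y + front) && vertical_flip s x y d T T']].

Definition perform_flip (s W H : nat) (v : vertex W H) (d : bool)
    (T : tiling s W H) : tiling s W H :=
  odflt T [pick T' : tiling s W H | flip_at s v d (val T) (val T')].

(* A rectangle without inner vertices has a single tiling (as 2 <= s), at which
   the chain stays. *)
Definition MC_square (R : realType) (s W H : nat) (T T' : tiling s W H) : R :=
  if #|inner_vertices W H| == 0%N then (T == T')%:R
  else \sum_(v in inner_vertices W H) \sum_(d : bool)
         (#|inner_vertices W H|%:R)^-1 * 2^-1 * (perform_flip v d T == T')%:R.

(* Integer part of the logarithm of n in base b. *)
Definition log_floor (R : realType) (b : R) (n : nat) : nat :=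
  Num.truncn (ln (n%:R : R) / ln b).

(* Main.v *)
Require Import Defs.
From HB Require Import structures.
From mathcomp Require Import all_boot all_order all_algebra.
From mathcomp Require Import all_classical all_reals all_analysis.
From mathcomp Require Import ring lra zify.

(* A tiling is determined by its large squares, so it is an independent set of a
   conflict graph on the cells.  Listing the cells column by column, conflicting
   cells are less than B = s * H apart.  The canonical path from X to Y sweeps
   through this list: it removes the squares of X and, B cells behind, inserts
   those of Y, using central flips only.  A state of the path together with the
   complementary mixture of X and Y and their restrictions to the gap determine
   the pair (X, Y), so the congestion is 2 ^ O(B) up to a polynomial factor, and
   this is polynomial in n when H is logarithmic.  The resulting Poincare
   inequality gives the contraction in l^2, because the chain is symmetric and
   lazy: at each vertex at most one of the two directions admits a flip. *)

Set Implicit Arguments.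
Unset Strict Implicit.
Unset Printing Implicit Defensive.

Import Order.TTheory GRing.Theory Num.Theory.

Local Open Scope ring_scope.

(** * Mixing time from a Poincare inequality *)

(** Both sides equal [2 * #|I| ^ 2] times the variance of [f] under the uniform distribution. *)
Lemma sum_sqr_sub (R : realType) (I : finType) (f : I -> R) :
  \sum_i \sum_j (f i - f j) ^+ 2 =
  2 * #|I|%:R * \sum_i f i ^+ 2 - 2 * (\sum_i f i) ^+ 2.
Proof.
have inner i : \sum_j (f i - f j) ^+ 2 =
    #|I|%:R * f i ^+ 2 - 2 * (\sum_j f j) * f i + \sum_j f j ^+ 2.
  under eq_bigr => j _ do rewrite sqrrB.
  rewrite big_split sumrB /= sumr_const -mulr_natl sumrMnl -mulr_sumr.
  by congr (_ - _ + _); rewrite -mulr_natl; ring.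
under eq_bigr => i _ do rewrite inner.
rewrite big_split sumrB /= -!mulr_sumr sumr_const -mulr_natl.
by ring.
Qed.

(** Cauchy-Schwarz against the constant function 1. It serves both to pass from l^1 to l^2 and to
    bound increments along a path. *)
Lemma sqr_sum_le (R : realType) (I : finType) (f : I -> R) :
  (\sum_i f i) ^+ 2 <= #|I|%:R * \sum_i f i ^+ 2.
Proof.
have : 0 <= \sum_i \sum_j (f i - f j) ^+ 2.
  by apply: sumr_ge0 => i _; apply: sumr_ge0 => j _; exact: sqr_ge0.
rewrite sum_sqr_sub; lra.
Qed.

Section Mixing.
Variables (R : realType) (S : finType) (P : S -> S -> R).
Hypothesis P_ge0 : forall x y, 0 <= P x y.
Hypothesis P_sum1 : forall x, \sum_y P x y = 1.
Hypothesis P_sym : forall x y, P x y = P y x.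

Lemma kernel_powSr t x y :
  kernel_pow P t.+1 x y = \sum_z kernel_pow P t x z * P z y.
Proof.
elim: t x y => [|t IHt] x y /=.
  rewrite (bigD1 y) //= eqxx mulr1 big1 => [|z /negbTE ->].
    2: by rewrite mulr0.
  rewrite addr0 (bigD1 x) //= eqxx mul1r big1 ?addr0 // => z.
  by rewrite eq_sym => /negbTE ->; rewrite mul0r.
transitivity (\sum_z P x z * \sum_w kernel_pow P t z w * P w y).
  by apply: eq_bigr => z _; rewrite -IHt.
transitivity (\sum_z \sum_w P x z * (kernel_pow P t z w * P w y)).
  by apply: eq_bigr => z _; rewrite mulr_sumr.
rewrite exchange_big /=; apply: eq_bigr => w _.
by rewrite mulr_suml; apply: eq_bigr => z _; rewrite mulrA.
Qed.

Lemma kernel_pow_sym t x y : kernel_pow P t x y = kernel_pow P t y x.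
Proof.
elim: t x y => [|t IHt] x y; first by rewrite /= eq_sym.
rewrite kernel_powSr /=; apply: eq_bigr => z _.
by rewrite IHt (P_sym z) mulrC.
Qed.

(** This is [2 * #|S|] times the usual Dirichlet form for the uniform distribution. *)
Definition dirichlet (f : S -> R) := \sum_x \sum_y P x y * (f x - f y) ^+ 2.

Definition apply_kernel (f : S -> R) x := \sum_y P x y * f y.

Lemma sum_apply_kernel f : \sum_x apply_kernel f x = \sum_x f x.
Proof.
rewrite exchange_big /=; apply: eq_bigr => y _.
by rewrite -mulr_suml (eq_bigr (P y)) ?P_sum1 ?mul1r.
Qed.

(* The right-hand side is half the Dirichlet form of the squared kernel, whose
   (x, y) entry is at least [P x x * P x y]. *)
Lemma sqr_kernel_dirichlet f : (forall x, 2^-1 <= P x x) ->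
  4^-1 * dirichlet f <= \sum_x f x ^+ 2 - \sum_x apply_kernel f x ^+ 2.
Proof.
move=> lazy.
pose Q x y := \sum_z P x z * P z y.
have Q_ge x y : 2^-1 * P x y <= Q x y.
  rewrite /Q (bigD1 x) //= -[leLHS]addr0 lerD ?ler_wpM2r //.
  by apply: sumr_ge0 => z _; rewrite mulr_ge0.
have Qsym x y : Q x y = Q y x.
  by apply: eq_bigr => z _; rewrite mulrC P_sym (P_sym x).
have Q1 x : \sum_y Q x y = 1.
  rewrite exchange_big /= -[RHS](P_sum1 x); apply: eq_bigr => z _.
  by rewrite -mulr_sumr P_sum1 mulr1.
have QP : \sum_x apply_kernel f x ^+ 2 = \sum_x \sum_y Q x y * (f x * f y).
  transitivity (\sum_z \sum_x \sum_y P z x * P z y * (f x * f y)).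
    apply: eq_bigr => z _; rewrite expr2 /apply_kernel mulr_suml.
    apply: eq_bigr => x _; rewrite mulr_sumr; apply: eq_bigr => y _; ring.
  rewrite exchange_big; apply: eq_bigr => x _ /=.
  rewrite exchange_big; apply: eq_bigr => y _ /=.
  by rewrite mulr_suml; apply: eq_bigr => z _; rewrite (P_sym z x).
have -> : \sum_x f x ^+ 2 - \sum_x apply_kernel f x ^+ 2 =
    2^-1 * \sum_x \sum_y Q x y * (f x - f y) ^+ 2.
  have sqE : \sum_x \sum_y Q x y * f x ^+ 2 = \sum_x f x ^+ 2.
    by apply: eq_bigr => x _; rewrite -mulr_suml Q1 mul1r.
  have sqE' : \sum_x \sum_y Q x y * f y ^+ 2 = \sum_x f x ^+ 2.
    rewrite exchange_big /=; apply: eq_bigr => y _.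
    by rewrite -mulr_suml (eq_bigr (Q y)) ?Q1 ?mul1r.
  transitivity (2^-1 * (\sum_x \sum_y Q x y * f x ^+ 2
    + \sum_x \sum_y Q x y * f y ^+ 2 - 2 * \sum_x \sum_y Q x y * (f x * f y))).
    by rewrite sqE sqE' QP; field.
  congr (_ * _); rewrite mulr_sumr -big_split -sumrB /=; apply: eq_bigr => x _.
  by rewrite mulr_sumr -big_split -sumrB /=; apply: eq_bigr => y _; ring.
have -> : 4^-1 * dirichlet f =
    2^-1 * \sum_x \sum_y 2^-1 * P x y * (f x - f y) ^+ 2.
  rewrite /dirichlet !mulr_sumr; apply: eq_bigr => x _.
  by rewrite !mulr_sumr; apply: eq_bigr => y _; field.
rewrite ler_pM2l ?invr_gt0 ?ltr0n //.
by apply: ler_sum => x _; apply: ler_sum => y _; rewrite ler_wpM2r ?sqr_ge0.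
Qed.

Hypothesis P_lazy : forall x, 2^-1 <= P x x.
Variable M : nat.
Hypothesis M_gt0 : (0 < M)%N.
Hypothesis poincare : forall f : S -> R,
  \sum_x \sum_y (f x - f y) ^+ 2 <= 2^-1 * M%:R * #|S|%:R * dirichlet f.

(** For [f] of sum zero, [poincare] bounds a quarter of the Dirichlet form below by [M%:R^-1] times
    the squared norm, and one step of the lazy chain loses at least that quarter. *)
Lemma contraction f : \sum_x f x = 0 ->
  \sum_x apply_kernel f x ^+ 2 <= (1 - M%:R^-1) * \sum_x f x ^+ 2.
Proof.
move=> f0; have [S0|S_gt0] := posnP #|S|.
  have S_empty (x : S) : False by have := card0_eq S0 x; rewrite inE.
  by rewrite !big1 ?mulr0 // => x; case: (S_empty x).
have S_gt0R : 0 < #|S|%:R :> R by rewrite ltr0n.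
have M_gt0R : 0 < M%:R :> R by rewrite ltr0n.
have := poincare f; rewrite sum_sqr_sub f0 expr0n mulr0 subr0.
have -> : 2 * #|S|%:R * \sum_i f i ^+ 2 =
  #|S|%:R * (2 * \sum_i f i ^+ 2) by ring.
have -> : 2^-1 * M%:R * #|S|%:R * dirichlet f =
  #|S|%:R * (2^-1 * M%:R * dirichlet f) by ring.
rewrite ler_pM2l // => le_dir.
have := sqr_kernel_dirichlet f P_lazy.
have : M%:R^-1 * (2 * \sum_i f i ^+ 2) <= 2^-1 * dirichlet f.
  by rewrite ler_pdivrMl //; move: le_dir; rewrite mulrCA mulrA.
lra.
Qed.

(** Viewed as a function of the starting point [x] with [y] fixed, so that a step of the chain is
    [apply_kernel]. *)
Let dev t x y : R := kernel_pow P t x y - uniform_dist R x.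

Lemma dev_sum0 t y : \sum_x dev t x y = 0.
Proof.
have S_gt0 : #|S|%:R != 0 :> R.
  by rewrite pnatr_eq0 -lt0n; apply/card_gt0P; exists y.
rewrite /dev sumrB /uniform_dist sumr_const -[_^-1 *+ _]mulr_natr mulVf //.
apply/eqP; rewrite subr_eq0; apply/eqP; elim: t => [|t IHt].
  rewrite (bigD1 y) //= eqxx big1 ?addr0 // => z /negbTE; by move=> ->.
by rewrite -[RHS]IHt -[RHS]sum_apply_kernel.
Qed.

Lemma devS t x y : dev t.+1 x y = apply_kernel (dev t ^~ y) x.
Proof.
rewrite /dev /apply_kernel /=; under [RHS]eq_bigr => z _ do rewrite mulrBr.
by rewrite sumrB -mulr_suml P_sum1 mul1r.
Qed.

Lemma dev_sqr_le t y : \sum_x dev t x y ^+ 2 <= (1 - M%:R^-1) ^+ t.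
Proof.
have M_le1 : M%:R^-1 <= 1 :> R by rewrite invf_le1 ?ltr0n // ler1n.
elim: t => [|t IHt].
  rewrite expr0.
  have S_gt0 : 0 < #|S|%:R :> R by rewrite ltr0n; apply/card_gt0P; exists y.
  (* A point mass at [y] minus the uniform distribution. *)
  have -> : \sum_x dev 0 x y ^+ 2 = 1 - #|S|%:R^-1.
    have dev0E x : dev 0 x y ^+ 2 =
        (x == y)%:R * (1 - 2 * #|S|%:R^-1) + #|S|%:R^-2.
      rewrite /dev /= /uniform_dist; rewrite -exprVn.
      by case: (x == y) => /=; ring.
    under eq_bigr => x _ do rewrite dev0E.
    rewrite big_split -mulr_suml /= sumr_const -[_^-1 *+ _]mulr_natl.
    rewrite (bigD1 y) //= eqxx big1 => [|z /negbTE -> //].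
    by rewrite -[#|xpredT|]/#|S| -[true%:R]/1; field; rewrite gt_eqF.
  by rewrite gerBl invr_ge0 ltW.
rewrite exprS; under eq_bigr => x _ do rewrite devS.
apply: le_trans (contraction (dev_sum0 t y)) _.
by rewrite ler_wpM2l // subr_ge0.
Qed.

Lemma expr_le_half : (1 - M%:R^-1) ^+ M <= 2^-1 :> R.
Proof.
have M_gt0R : 0 < M%:R :> R by rewrite ltr0n.
have M_le1 : M%:R^-1 <= 1 :> R by rewrite invf_le1 // ler1n.
(* A Bernoulli-type bound; at [k = M] the second factor is 2. *)
have bern k : (1 - M%:R^-1) ^+ k * (1 + k%:R * M%:R^-1) <= 1 :> R.
  elim: k => [|k IHk]; first by rewrite expr0 mul0r addr0 mul1r.
  apply: le_trans IHk; rewrite exprSr -mulrA ler_wpM2l ?exprn_ge0 ?subr_ge0 //.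
  have := invr_ge0 (M%:R : R); have := ler0n R k.
  rewrite (ltW M_gt0R) -natr1; nra.
have := bern M; rewrite mulfV ?gt_eqF //; lra.
Qed.

(** Every [M] steps halve the bound on the squared l^2 deviation, so it is at most [2 ^ - k] after
    [M * k] steps. Cauchy-Schwarz costs a factor [#|S|], so the l^1 distance is at most 1/2 and the
    total variation distance at most 1/4. *)
Lemma mixing_time_le k : (4 * #|S| <= 2 ^ k)%N ->
  (mixing_time P (@uniform_dist R S) <= ((M * k)%:R)%:E)%E.
Proof.
move=> le_S; apply: (big_ind (fun z => (z <= ((M * k)%:R)%:E)%E)).
- exact: leNye.
- by move=> u v le_u le_v; rewrite ge_max le_u.
move=> x _; apply: ereal_inf_lbound; exists (M * k)%N => //= t le_t.
have M_le1 : M%:R^-1 <= 1 :> R by rewrite invf_le1 ?ltr0n // ler1n.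
have S_gt0 : 0 < #|S|%:R :> R by rewrite ltr0n; apply/card_gt0P; exists x.
rewrite /tv_dist.
(* Symmetry of the kernel exchanges start and end point, which turns the distance from [x] into a
   sum over the first argument of [dev]. *)
have tvE : \sum_y `|kernel_pow P t x y - uniform_dist R y| =
    \sum_y `|dev t y x|.
  by apply: eq_bigr => y _; rewrite /dev kernel_pow_sym.
rewrite tvE; have : (\sum_y `|dev t y x|) ^+ 2 <= 2^-1 ^+ 2.
  apply: le_trans (sqr_sum_le _) _.
  under eq_bigr => y _ do rewrite real_normK ?num_real //.
  have : \sum_y dev t y x ^+ 2 <= 2^-1 ^+ k.
    apply: le_trans (dev_sqr_le _ _) _.
    apply: le_trans (_ : (1 - M%:R^-1) ^+ (M * k) <= _).
      by rewrite ler_wiXn2l ?subr_ge0 // gerBl invr_ge0 ler0n.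
    by rewrite exprM lerXn2r ?nnegrE ?exprn_ge0 ?subr_ge0 ?expr_le_half.
  move=> /(ler_wpM2l (ltW S_gt0)) /le_trans; apply.
  rewrite exprVn ler_pdivrMr ?exprn_gt0 //.
  have : (4 * #|S|)%:R <= (2 ^ k)%:R :> R by rewrite ler_nat.
  rewrite natrM natrX; lra.
rewrite ler_sqr ?nnegrE ?sumr_ge0 //; lra.
Qed.

End Mixing.

(** * Canonical paths for codes of bounded range *)

Section CanonicalPaths.
Variables (R : realType) (S : finType) (code : S -> nat -> bool).
Hypothesis code_inj : forall X Y, code X =1 code Y -> X = Y.
Variables (B L : nat).
(** Positions start at [B], so that the mixture with [a = 0] and [c = B] loses nothing of [X]. *)
Hypothesis code_lt : forall X i, code X i -> (B <= i < L)%N.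
Variable mix : S -> S -> nat -> nat -> S.
Hypothesis code_mix : forall X Y a c, (a + B <= c)%N -> forall i,
  code (mix X Y a c) i = if (i < a)%N then code Y i else (c <= i)%N && code X i.

(** Along the path the gap between [a] and [c] has length [B] or [B.+1]; these bits record what both
    mixtures erase there. *)
Definition window (a : nat) (X : S) : {ffun 'I_B.+1 -> bool} :=
  [ffun j : 'I_B.+1 => code X (a + j)].

(* The pair (X, Y) can be read off a state of the path together with the state
   of the reversed mixture and the two windows. *)
Lemma encoding_inj a c : (a + B <= c <= a + B.+1)%N ->
  injective (fun XY : S * S =>
    (mix XY.1 XY.2 a c, mix XY.2 XY.1 a c, window a XY.1, window a XY.2)).
Proof.
move=> /andP[le_ac le_ca] [X Y] [X' Y'] /= [eqZ eqW eqX eqY].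
have eq_codes i : code X i = code X' i /\ code Y i = code Y' i.
  have [lt_ia|le_ai] := ltnP i a.
    have := congr1 (code ^~ i) eqZ; have := congr1 (code ^~ i) eqW.
    by rewrite !code_mix // lt_ia.
  have [le_ci|lt_ic] := leqP c i.
    have := congr1 (code ^~ i) eqZ; have := congr1 (code ^~ i) eqW.
    by rewrite !code_mix // ltnNge le_ai le_ci.
  have lt_iB : (i - a < B.+1)%N by lia.
  have := congr1 (fun w : {ffun _} => w (Ordinal lt_iB)) eqX.
  have := congr1 (fun w : {ffun _} => w (Ordinal lt_iB)) eqY.
  by rewrite !ffunE /= subnKC.
by congr (_, _); apply: code_inj => i; have [] := eq_codes i.
Qed.

(** Congestion bound: given the state [Z] of the path, the injective encoding leaves at most [#|S|]
    reversed mixtures and [2 ^ B.+1] values for each of the two windows. *)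
Lemma sum_mix_le a c (G : S -> R) : (forall Z, 0 <= G Z) ->
  (a + B <= c <= a + B.+1)%N ->
  \sum_X \sum_Y G (mix X Y a c) <=
  #|S|%:R * (4 ^ B.+1)%:R * \sum_Z G Z.
Proof.
move=> G_ge0 le_ac; rewrite pair_bigA /=.
pose I := {ffun 'I_B.+1 -> bool}.
pose enc (XY : S * S) : S * S * I * I :=
  (mix XY.1 XY.2 a c, mix XY.2 XY.1 a c, window a XY.1, window a XY.2).
have enc_inj : injective enc by exact: encoding_inj.
have -> : \sum_(XY : S * S) G (mix XY.1 XY.2 a c) =
    \sum_(t in codom enc) G t.1.1.1.
  rewrite -[RHS]big_uniq; last exact/injectiveP.
  by rewrite /codom /image_mem big_map big_enum.
have -> : #|S|%:R * (4 ^ B.+1)%:R * \sum_Z G Z =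
    \sum_(t : S * S * I * I) G t.1.1.1.
  rewrite -(pair_bigA _ (fun (t : S * S * I) (_ : I) => G t.1.1)) /=.
  rewrite -(pair_bigA _ (fun (t : S * S) (_ : I) => \sum_(_ : I) G t.1)) /=.
  rewrite -(pair_bigA _
    (fun (t : S) (_ : S) => \sum_(_ : I) \sum_(_ : I) G t)) /=.
  rewrite mulr_sumr; apply: eq_bigr => Z _.
  rewrite !sumr_const card_ffun card_bool card_ord -!mulrnA.
  rewrite -[RHS]mulr_natl -natrM; congr (_%:R * _).
  by rewrite mulnC mulnA -expnMn.
rewrite big_mkcond /=; apply: ler_sum => t _; case: ifP => // _.
Qed.

Variable P : S -> S -> R.
Hypothesis P_ge0 : forall x y, 0 <= P x y.
Variable K : nat.
Hypothesis K_gt0 : (0 < K)%N.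
Hypothesis P_single : forall X Y i,
  (forall j, j != i -> code X j = code Y j) -> X != Y -> K%:R^-1 <= P X Y.

(** The term [Z = Y] of the sum suffices. The case [X = Y] occurs when the path finds nothing to
    erase or insert at a position. *)
Lemma single_step_le (f : S -> R) X Y i :
  (forall j, j != i -> code X j = code Y j) ->
  (f X - f Y) ^+ 2 <= K%:R * \sum_Z P X Z * (f X - f Z) ^+ 2.
Proof.
move=> eqXY; have K_gt0R : 0 < K%:R :> R by rewrite ltr0n.
have sum_ge0 (A : pred S) : 0 <= \sum_(Z | A Z) P X Z * (f X - f Z) ^+ 2.
  by apply: sumr_ge0 => Z _; rewrite mulr_ge0 ?sqr_ge0.
have [<-|neqXY] := eqVneq X Y.
  by rewrite subrr expr0n mulr_ge0 ?sum_ge0 // ltW.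
rewrite -ler_pdivrMl // (bigD1 Y) //= -[leLHS]addr0 lerD //.
by rewrite ler_wpM2r ?sqr_ge0 // (P_single eqXY).
Qed.

(** In the constant [4 * L ^ 2], one [L] comes from Cauchy-Schwarz along the path and one from
    summing over its positions; one 2 comes from splitting a double step and one from adding its two
    halves. *)
Lemma path_poincare f :
  \sum_X \sum_Y (f X - f Y) ^+ 2 <=
  4 * L%:R ^+ 2 * (4 ^ B.+1)%:R * K%:R * #|S|%:R * dirichlet P f.
Proof.
pose G Z := K%:R * \sum_Z' P Z Z' * (f Z - f Z') ^+ 2.
have G_ge0 Z : 0 <= G Z.
  rewrite mulr_ge0 //; apply: sumr_ge0 => Z' _.
  by rewrite mulr_ge0 ?sqr_ge0.
have mix0 X Y : mix X Y 0 B = X.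
  apply: code_inj => i; rewrite code_mix //=.
  by case Xi: (code X i); rewrite ?andbF // (andP (code_lt Xi)).1.
have mixL X Y : mix X Y L (L + B) = Y.
  apply: code_inj => i; rewrite code_mix //.
  have [lt_iL|le_Li] := ltnP i L; first by [].
  have out Z : code Z i = false.
    by apply/negP => /code_lt /andP[_]; rewrite ltnNge le_Li.
  by rewrite !out andbF.
(* First half of a double step: position [j + B] of [X] is erased. *)
have step1 X Y j : (f (mix X Y j (j + B)) - f (mix X Y j (j + B.+1))) ^+ 2 <=
    G (mix X Y j (j + B)).
  apply: (@single_step_le f _ _ (j + B)%N) => k neq.
  rewrite !code_mix ?leq_add2l //; case: ifP => // _.
  by congr (_ && _); lia.
(* Second half: position [j] of [Y] is inserted, and the gap shrinks back to length [B]. *)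
have step2 X Y j :
    (f (mix X Y j (j + B.+1)) - f (mix X Y j.+1 (j.+1 + B))) ^+ 2 <=
    G (mix X Y j (j + B.+1)).
  apply: (@single_step_le f _ _ j) => k neq.
  rewrite !code_mix ?leq_add2l // addSnnS.
  have -> : (k < j.+1)%N = (k < j)%N by lia.
  by [].
have path_le X Y : (f X - f Y) ^+ 2 <=
    2 * L%:R * \sum_(j < L) (G (mix X Y j (j + B)) + G (mix X Y j (j + B.+1))).
  have -> : f X - f Y =
      \sum_(j < L) (f (mix X Y j (j + B)) - f (mix X Y j.+1 (j.+1 + B))).
    rewrite -{1}(mix0 X Y) -{2}(mixL X Y) -opprB.
    rewrite -(telescope_sumr (fun j => f (mix X Y j (j + B)))) // big_mkord.
    by rewrite -sumrN; apply: eq_bigr => j _; rewrite opprB.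
  apply: le_trans (sqr_sum_le _) _; rewrite card_ord [2 * _]mulrC -mulrA.
  rewrite ler_wpM2l // mulr_sumr; apply: ler_sum => j _.
  set u := f (mix X Y j (j + B)); set w := f (mix X Y j.+1 _).
  apply: le_trans (_ : 2 * ((u - f (mix X Y j (j + B.+1))) ^+ 2 +
    (f (mix X Y j (j + B.+1)) - w) ^+ 2) <= _).
    have := sqr_ge0 (u - f (mix X Y j (j + B.+1)) -
      (f (mix X Y j (j + B.+1)) - w)).
    nra.
  by rewrite ler_wpM2l // lerD ?step1 ?step2.
apply: (@le_trans _ _ (2 * L%:R * \sum_(j < L)
    2 * (#|S|%:R * (4 ^ B.+1)%:R * \sum_Z G Z))).
  apply: (@le_trans _ _ (2 * L%:R * \sum_(j < L) \sum_X \sum_Y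
      (G (mix X Y j (j + B)) + G (mix X Y j (j + B.+1))))).
    rewrite [X in _ * X]exchange_big mulr_sumr; apply: ler_sum => X _ /=.
    rewrite [X in _ * X]exchange_big mulr_sumr; apply: ler_sum => Y _ /=.
    exact: path_le.
  rewrite ler_wpM2l ?mulr_ge0 //; apply: ler_sum => j _.
  under eq_bigr => X _ do rewrite big_split.
  rewrite big_split /= [leRHS]mulr_natl mulr2n.
  by rewrite lerD // sum_mix_le // !leq_add2l leqnn ?leqnSn.
rewrite sumr_const card_ord -[X in _ * X]mulr_natl /G -mulr_sumr.
rewrite -/(dirichlet P f) le_eqVlt; apply/orP; left; apply/eqP; ring.
Qed.

End CanonicalPaths.

(** * Tilings as packings of squares *)

Section Tilings.
Variables (s W H : nat).
Implicit Types (c : cell W H) (t : tile W H) (T A : {set tile W H})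
  (Q : {set cell W H}).

Lemma tilingP T : reflect
  [/\ forall t, t \in T -> tile_inside s t,
      forall c, exists2 t, t \in T & c \in tile_cells s t
    & forall c t t', t \in T -> t' \in T ->
        c \in tile_cells s t -> c \in tile_cells s t' -> t = t']
  (is_tiling s T).
Proof.
have covE c u : (u \in [set t in T | c \in tile_cells s t]) =
  (u \in T) && (c \in tile_cells s u) by rewrite !inE.
apply: (iffP andP) => [[/forall_inP inT /forallP covT]|[inT ex_cov uniq_cov]].
  split=> // [c|c t t' tT t'T ct ct'].
    have /cards1P[t /setP/(_ t)] := covT c.
    by rewrite covE set11 => /andP[tT ct]; exists t.
  have /cards1P[u /setP cov_u] := covT c.
  have := cov_u t; have := cov_u t'.
  rewrite !covE tT t'T ct ct' !finset.in_set1.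
  by move=> /esym/eqP-> /esym/eqP->.
split; first exact/forall_inP.
apply/forallP => c; have [t tT ct] := ex_cov c.
apply/cards1P; exists t; apply/setP => t'; rewrite covE finset.in_set1.
apply/andP/eqP => [[t'T ct']|-> //]; exact: uniq_cov ct' ct.
Qed.

Definition bigs T : {set cell W H} := [set c | (c, true) \in T].

Lemma mem_bigs T c : (c \in bigs T) = ((c, true) \in T).
Proof. by rewrite inE. Qed.

Definition square c := tile_cells s (c, true).

Definition packing Q :=
  [forall c in Q, tile_inside s (c, true)] &&
  [forall c in Q, forall c' in Q,
    (c != c') ==> [disjoint square c & square c']].

(** On packings this is the inverse of [bigs]: the cells left uncovered by the squares become unit
    tiles. *)
Definition fill Q : {set tile W H} :=
  [set t | if t.2 then t.1 \in Q else [forall c in Q, t.1 \notin square c]].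

Lemma mem_unit_cells c e : (e \in tile_cells s (c, false)) = (e == c).
Proof.
rewrite inE /= !addn1 !ltnS -!eqn_leq [RHS]eq_sym.
by case: e c => [e1 e2] [c1 c2].
Qed.

Lemma bigs_fill Q : bigs (fill Q) = Q.
Proof. by apply/setP => c; rewrite !inE. Qed.

Lemma packingP Q : reflect
  ((forall c, c \in Q -> tile_inside s (c, true)) /\
   (forall c c' e, c \in Q -> c' \in Q -> e \in square c -> e \in square c' ->
      c = c'))
  (packing Q).
Proof.
apply: (iffP andP) => -[in_Q disj].
  split=> [|c c' e cQ c'Q ec ec']; first exact/forall_inP.
  apply: contraTeq isT => neq.
  have /forall_inP/(_ c cQ)/forall_inP/(_ c' c'Q)/implyP/(_ neq) := disj.
  by move=> /disjointFr/(_ ec); rewrite ec'.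
split; first exact/forall_inP.
apply/forall_inP => c cQ; apply/forall_inP => c' c'Q; apply/implyP.
apply: contraNT => /pred0Pn[e /andP[ec ec']].
by apply/eqP; exact: disj ec ec'.
Qed.

Lemma fill_tiling Q : packing Q -> is_tiling s (fill Q).
Proof.
move=> /packingP[in_Q disj]; apply/tilingP; split.
- move=> [c [|]]; rewrite inE /=; first exact: in_Q.
  by move=> _; rewrite /tile_inside /= !addn1 !ltn_ord.
- move=> e; have [/existsP[c /andP[cQ ec]]|] :=
    boolP [exists c, (c \in Q) && (e \in square c)].
    by exists (c, true) => //; rewrite inE.
  rewrite negb_exists => /forallP no_sq; exists (e, false).
    rewrite inE /=; apply/forall_inP => c cQ.
    by have := no_sq c; rewrite cQ.
  by rewrite mem_unit_cells.
- move=> e [c [|]] [c' [|]]; rewrite ?[_ \in fill _]inE /=.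
  + by move=> cQ c'Q ec ec'; rewrite (disj c c' e).
  + move=> cQ /forall_inP/(_ c cQ) c'c ec.
    by rewrite mem_unit_cells => /eqP eq_e; rewrite -eq_e ec in c'c.
  + move=> /forall_inP unc c'Q; rewrite mem_unit_cells => /eqP -> cc'.
    by have := unc c' c'Q; rewrite cc'.
  + by move=> _ _; rewrite !mem_unit_cells => /eqP <- /eqP <-.
Qed.

Lemma bigs_packing T : is_tiling s T -> packing (bigs T).
Proof.
move=> /tilingP[inT _ uniq_cov]; apply/packingP; split=> [c|c c' e].
  by rewrite mem_bigs; apply: inT.
by rewrite !mem_bigs => cT c'T ec ec'; case: (uniq_cov _ _ _ cT c'T ec ec').
Qed.

Lemma fill_bigs T : is_tiling s T -> fill (bigs T) = T.
Proof.
move=> /tilingP[inT ex_cov uniq_cov]; apply/setP => -[c [|]];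
  rewrite [LHS]inE /= ?mem_bigs //.
apply/forall_inP/idP => [unc|cT c'].
  have [[c' [|]] c'T] := ex_cov c.
    by move=> cc'; have := unc c'; rewrite mem_bigs c'T cc' => /(_ isT).
  by rewrite mem_unit_cells => /eqP ->.
rewrite mem_bigs => c'T; apply/negP => cc'.
by have := uniq_cov c _ _ c'T cT cc'; rewrite mem_unit_cells eqxx => /(_ isT).
Qed.

Lemma bigs_inj T T' : is_tiling s T -> is_tiling s T' ->
  bigs T = bigs T' -> T = T'.
Proof. by move=> /fill_bigs {2}<- /fill_bigs {2}<- ->. Qed.

(** * Tiles addressed by natural coordinates *)

Definition has_tile T x y b :=
  [exists c : cell W H,
    [&& nat_of_ord c.1 == x, nat_of_ord c.2 == y & (c, b) \in T]].

Lemma has_tileP T x y b : reflect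
  (exists c : cell W H,
    [/\ nat_of_ord c.1 = x, nat_of_ord c.2 = y & (c, b) \in T])
  (has_tile T x y b).
Proof.
apply: (iffP existsP) => -[c]; first by move=> /and3P[/eqP ? /eqP ?]; exists c.
by case=> <- <- cT; exists c; rewrite !eqxx.
Qed.

Lemma has_tileE T c b : has_tile T c.1 c.2 b = ((c, b) \in T).
Proof.
apply/has_tileP/idP => [[c' [eq1 eq2]]|cT]; last by exists c.
have -> // : c' = c.
by case: c c' eq1 eq2 => [c1 c2] [c1' c2'] /= /val_inj-> /val_inj->.
Qed.

Lemma has_tile_conflict T x y b x' y' b' i j : is_tiling s T ->
  has_tile T x y b -> has_tile T x' y' b' ->
  (x <= i < x + side s b)%N -> (y <= j < y + side s b)%N ->
  (x' <= i < x' + side s b')%N -> (y' <= j < y' + side s b')%N ->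
  [/\ x = x', y = y' & b = b'].
Proof.
move=> /tilingP[inT _ uniq_cov] /has_tileP[c [<- <- cT]].
move=> /has_tileP[c' [<- <- c'T]] ix jy ix' jy'.
have /andP[inW inH] := inT _ cT.
have i_lt : (i < W)%N by case/andP: ix => _ /leq_trans; exact.
have j_lt : (j < H)%N by case/andP: jy => _ /leq_trans; exact.
pose e : cell W H := (Ordinal i_lt, Ordinal j_lt).
have ec : e \in tile_cells s (c, b) by rewrite inE /= ix jy.
have ec' : e \in tile_cells s (c', b') by rewrite inE /= ix' jy'.
by have [-> ->] := uniq_cov _ _ _ cT c'T ec ec'.
Qed.

Lemma sq_sq T x y x' y' : is_tiling s T ->
  has_tile T x y true -> has_tile T x' y' true ->
  (x < x' + s)%N -> (x' < x + s)%N -> (y < y' + s)%N -> (y' < y + s)%N ->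
  x = x' /\ y = y'.
Proof.
move=> tT h h' ? ? ? ?.
(* The coordinatewise maximum of the two corners is a cell common to both squares. *)
by have [] := @has_tile_conflict _ _ _ _ _ _ _ (maxn x x') (maxn y y')
  tT h h'; rewrite /=; lia.
Qed.

Lemma sq_unit T x y i j : is_tiling s T ->
  has_tile T x y true -> has_tile T i j false ->
  (x <= i < x + s)%N -> (y <= j < y + s)%N -> False.
Proof.
move=> tT h h' ? ?.
by have [] := @has_tile_conflict _ _ _ _ _ _ _ i j tT h h'; rewrite /=; lia.
Qed.

(* [r] and [a] are the places where a square of [T] disappears and where a new
   square of [T'] appears, if any. *)
Definition change T T' (r a : option (nat * nat)) :=
  [/\ forall p, r = Some p -> has_tile T p.1 p.2 true,
      forall p, a = Some p -> ~~ has_tile T p.1 p.2 true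
    & forall i j, has_tile T' i j true =
        (a == Some (i, j)) || (r != Some (i, j)) && has_tile T i j true].

Lemma change_rev T T' r a : change T T' r a -> change T' T a r.
Proof.
case=> rT aT eqT'; split=> [p ap|p rp|i j].
- by rewrite eqT' ap -surjective_pairing eqxx.
- rewrite eqT' rp -surjective_pairing eqxx orbF; apply/eqP => ap.
  by have := aT p ap; rewrite rT.
rewrite eqT'; have [ra|_] /= := eqVneq r (Some (i, j)).
  by rewrite (rT _ ra).
by have [ai|_] /= := eqVneq a (Some (i, j)); rewrite // (negbTE (aT _ ai)).
Qed.

Lemma change_inj_removed T T' r a r' a' :
  change T T' r a -> change T T' r' a' -> r = r'.
Proof.
have sub r1 a1 r2 a2 p : change T T' r1 a1 -> change T T' r2 a2 ->
    r1 = Some p -> r2 = Some p.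
  move=> [r1T a1T eqT'1] [r2T a2T eqT'2] r1p.
  have Tp := r1T p r1p; have := eqT'2 p.1 p.2; have := eqT'1 p.1 p.2.
  rewrite r1p -surjective_pairing eqxx Tp orbF andbT => ->.
  case: eqP => [a1p|_]; first by have := a1T p a1p; rewrite Tp.
  by move/esym/negbT; rewrite negb_or negbK => /andP[_ /eqP].
move=> ch ch'; case: r ch => [p|] ch.
  by rewrite (sub _ _ _ _ _ ch ch' erefl).
by case: r' ch' => [p|] // ch'; rewrite (sub _ _ _ _ _ ch' ch erefl).
Qed.

(** The created square is the one removed by the reversed change. *)
Lemma change_inj T T' r a r' a' :
  change T T' r a -> change T T' r' a' -> r = r' /\ a = a'.
Proof.
move=> ch ch'; split; first exact: change_inj_removed ch ch'.
exact: change_inj_removed (change_rev ch) (change_rev ch').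
Qed.

Lemma has_tile_true_inj T T' : is_tiling s T -> is_tiling s T' ->
  (forall i j, has_tile T i j true = has_tile T' i j true) -> T = T'.
Proof.
move=> tT tT' eqTT'; apply: bigs_inj => //; apply/setP => c.
by rewrite !mem_bigs -!has_tileE.
Qed.

Lemma change_fun T T1 T2 r a : is_tiling s T1 -> is_tiling s T2 ->
  change T T1 r a -> change T T2 r a -> T1 = T2.
Proof.
move=> t1 t2 [_ _ eq1] [_ _ eq2]; apply: has_tile_true_inj => // i j.
by rewrite eq1 eq2.
Qed.

(** * Replacing the tiles of a block *)

Definition tiles A (D : {set cell W H}) :=
  (forall t, t \in A -> t.1 \in D) /\
  (forall c, c \in D -> exists2 t, t \in A & c \in tile_cells s t).

Lemma mem_tile_cells_corner t : (0 < s)%N -> t.1 \in tile_cells s t.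
Proof.
by move=> s_gt0; rewrite inE !leqnn /side; case: t.2; lia.
Qed.

(** The point is that a tile of [B] already in [T] belongs to [A]: its corner lies in [D], hence in
    a tile of [A], and [T] covers that corner only once. *)
Lemma replaces_rev A B D T T' : (0 < s)%N ->
  is_tiling s T -> tiles A D -> tiles B D -> replaces A B T T' ->
  replaces B A T' T.
Proof.
move=> s_gt0 /tilingP[_ _ uniq_cov] [inA covA] [inB covB].
move=> /andP[/fintype.subsetP sAT /eqP ->]; apply/andP; split.
  exact: finset.subsetUr.
have BT t : t \in B -> t \in T -> t \in A.
  move=> tB tT; have [u uA tu] := covA _ (inB _ tB).
  have -> // : t = u.
  by apply: uniq_cov tT _ _ tu; [exact: sAT | exact: mem_tile_cells_corner].
apply/eqP/setP => t; rewrite !inE.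
case tA: (t \in A); first by rewrite orbT sAT.
by case tB: (t \in B); case tT: (t \in T) => //=; rewrite BT ?tB in tA.
Qed.

Lemma tiles_units (D : {set cell W H}) : tiles (units D) D.
Proof.
split=> [t|c cD]; first by rewrite inE => /andP[].
by exists (c, false); rewrite ?mem_unit_cells // inE cD.
Qed.

Lemma tiles_one_square (D : {set cell W H}) x y : (0 < s)%N ->
  (x + s <= W)%N -> (y + s <= H)%N -> block W H x y s s \subset D ->
  tiles (one_square s D x y) D.
Proof.
move=> s_gt0 xW yH /fintype.subsetP sD.
have x_lt : (x < W)%N by lia.
have y_lt : (y < H)%N by lia.
split=> [t|c cD].
  rewrite !inE => /orP[/and3P[/eqP t1 /eqP t2 _]|/andP[/andP[_ ->] //]].
  by apply: sD; rewrite inE t1 t2; lia.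
have [c_in|c_out] := boolP (c \in block W H x y s s).
  by exists ((Ordinal x_lt, Ordinal y_lt), true); rewrite // !inE /= !eqxx.
exists (c, false); last by rewrite mem_unit_cells.
by rewrite finset.in_setU [X in _ || X]inE finset.in_setD c_out cD orbT.
Qed.

Lemma has_tile_one_square (D : {set cell W H}) x y i j :
  (x < W)%N -> (y < H)%N ->
  has_tile (one_square s D x y) i j true = ((x, y) == (i, j)).
Proof.
move=> xW yH; apply/has_tileP/eqP => [[c [<- <-]]|[<- <-]].
  by rewrite !inE andbF orbF /= andbT => /andP[/eqP -> /eqP ->].
by exists (Ordinal xW, Ordinal yH); rewrite !inE /= !eqxx.
Qed.

Lemma has_tile_units (D : {set cell W H}) i j :
  has_tile (units D) i j true = false.
Proof. by apply/has_tileP => -[c [_ _]]; rewrite inE andbF. Qed.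

Lemma has_tile_replaces A B T T' i j b : replaces A B T T' ->
  has_tile T' i j b =
  has_tile B i j b || ~~ has_tile A i j b && has_tile T i j b.
Proof.
move=> /andP[_ /eqP ->].
have [/existsP[c /andP[/eqP <- /eqP <-]]|no_c] :=
  boolP [exists c : cell W H,
    (nat_of_ord c.1 == i) && (nat_of_ord c.2 == j)].
  by rewrite !has_tileE !inE orbC.
have out A' : has_tile A' i j b = false.
  apply: contraNF no_c => /has_tileP[c [<- <- _]].
  by apply/existsP; exists c; rewrite !eqxx.
by rewrite !out.
Qed.

Lemma has_tile_subset A T i j b :
  A \subset T -> has_tile A i j b -> has_tile T i j b.
Proof.
move=> /fintype.subsetP sAT /has_tileP[c [i_c j_c cA]].
by apply/has_tileP; exists c; split=> //; apply: sAT.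
Qed.

Lemma has_tile_false_units x y w h i j : (i < W)%N -> (j < H)%N ->
  (x <= i < x + w)%N -> (y <= j < y + h)%N ->
  has_tile (units (block W H x y w h)) i j false.
Proof.
move=> iW jH xi yj; apply/has_tileP.
by exists (Ordinal iW, Ordinal jH); rewrite !inE /= xi yj.
Qed.

Lemma has_tile_false_one_square x y w h i j : (i < W)%N -> (j < H)%N ->
  (x <= i < x + w)%N -> (y <= j < y + h)%N ->
  ~~ ((x <= i < x + s)%N && (y <= j < y + s)%N) ->
  has_tile (one_square s (block W H x y w h) x y) i j false.
Proof.
move=> iW jH xi yj out; apply/has_tileP.
by exists (Ordinal iW, Ordinal jH); split=> //; rewrite !inE /= out xi yj orbT.
Qed.

(** * Reversal of the three kinds of flips and their effect on large squares *)

Hypothesis s_ge2 : (2 <= s)%N.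

Lemma central_flip_rev x y d T T' : is_tiling s T ->
  central_flip s x y d T T' -> central_flip s x y (~~ d) T' T.
Proof.
move=> tT /and3P[xW yH]; rewrite /central_flip xW yH /=.
have s_gt0 : (0 < s)%N by lia.
have tA := tiles_units (block W H x y s s).
have tB := tiles_one_square s_gt0 xW yH (subxx _).
case: d => rep; first exact: replaces_rev s_gt0 tT tA tB rep.
exact: replaces_rev s_gt0 tT tB tA rep.
Qed.

Lemma horizontal_flip_rev x y d T T' : is_tiling s T ->
  horizontal_flip s x y d T T' -> horizontal_flip s x y (~~ d) T' T.
Proof.
move=> tT /and3P[xW yH]; rewrite /horizontal_flip xW yH /=.
have s_gt0 : (0 < s)%N by lia.
set D := block W H x y s.+1 s; have tA : tiles (one_square s D x y) D.
  apply: tiles_one_square => //; first by lia.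
  by apply/fintype.subsetP => c; rewrite !inE; lia.
have tB : tiles (one_square s D x.+1 y) D.
  apply: tiles_one_square => //; first by lia.
  by apply/fintype.subsetP => c; rewrite !inE; lia.
case: d => rep; first exact: replaces_rev s_gt0 tT tA tB rep.
exact: replaces_rev s_gt0 tT tB tA rep.
Qed.

Lemma vertical_flip_rev x y d T T' : is_tiling s T ->
  vertical_flip s x y d T T' -> vertical_flip s x y (~~ d) T' T.
Proof.
move=> tT /and3P[xW yH]; rewrite /vertical_flip xW yH /=.
have s_gt0 : (0 < s)%N by lia.
set D := block W H x y s s.+1; have tA : tiles (one_square s D x y) D.
  apply: tiles_one_square => //; first by lia.
  by apply/fintype.subsetP => c; rewrite !inE; lia.
have tB : tiles (one_square s D x y.+1) D.
  apply: tiles_one_square => //; first by lia.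
  by apply/fintype.subsetP => c; rewrite !inE; lia.
case: d => rep; first exact: replaces_rev s_gt0 tT tA tB rep.
exact: replaces_rev s_gt0 tT tB tA rep.
Qed.

(** Only direction [true] is analysed, here and for the two moves below; the inverse flips follow by
    reversal. The unit tiles recorded along the way serve to exclude competing flips at the same
    vertex. *)
Lemma central_flip_change x y T T' : is_tiling s T ->
  central_flip s x y true T T' ->
  change T T' None (Some (x, y)) /\
  (forall i j, (x <= i < x + s)%N -> (y <= j < y + s)%N ->
    has_tile T i j false).
Proof.
move=> tT /and3P[xW yH rep].
have un i j : (x <= i < x + s)%N -> (y <= j < y + s)%N -> has_tile T i j false.
  move=> xi yj; apply: has_tile_subset (andP rep).1 _.
  by apply: has_tile_false_units; lia.
split=> //; split=> // [_ [<-]|i j] /=.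
  by apply/negP => Txy; apply: (sq_unit tT Txy (un x y _ _)); lia.
rewrite (has_tile_replaces _ _ _ rep) has_tile_units.
by rewrite has_tile_one_square //; lia.
Qed.

Lemma horizontal_flip_change x y T T' : is_tiling s T ->
  horizontal_flip s x y true T T' ->
  change T T' (Some (x, y)) (Some (x.+1, y)) /\
  (forall j, (y <= j < y + s)%N -> has_tile T (x + s) j false).
Proof.
move=> tT /and3P[xW yH rep].
have Txy : has_tile T x y true.
  apply: has_tile_subset (andP rep).1 _.
  by rewrite has_tile_one_square ?eqxx; lia.
split; last first.
  move=> j yj; apply: has_tile_subset (andP rep).1 _.
  by apply: has_tile_false_one_square; lia.
split=> [_ [<-] //|_ [<-]|i j] /=.
  by apply/negP => Txy'; have := sq_sq tT Txy Txy'; lia.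
by rewrite (has_tile_replaces _ _ _ rep) !has_tile_one_square //; lia.
Qed.

Lemma vertical_flip_change x y T T' : is_tiling s T ->
  vertical_flip s x y true T T' ->
  change T T' (Some (x, y)) (Some (x, y.+1)) /\
  (forall i, (x <= i < x + s)%N -> has_tile T i (y + s) false).
Proof.
move=> tT /and3P[xW yH rep].
have Txy : has_tile T x y true.
  apply: has_tile_subset (andP rep).1 _.
  by rewrite has_tile_one_square ?eqxx; lia.
split; last first.
  move=> j yj; apply: has_tile_subset (andP rep).1 _.
  by apply: has_tile_false_one_square; lia.
split=> [_ [<-] //|_ [<-]|i j] /=.
  by apply/negP => Txy'; have := sq_sq tT Txy Txy'; lia.
by rewrite (has_tile_replaces _ _ _ rep) !has_tile_one_square //; lia.
Qed.

End Tilings.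

(** * Flips as moves of squares *)

Lemma inner_vertexP (W H x y : nat) : (0 < x < W)%N -> (0 < y < H)%N ->
  exists2 v : vertex W H, v \in inner_vertices W H &
    forall x' y', vertex_at v x' y' = (x == x') && (y == y').
Proof.
move=> xW yH.
have x_lt : (x < W.+1)%N by lia.
have y_lt : (y < H.+1)%N by lia.
by exists (Ordinal x_lt, Ordinal y_lt); rewrite // inE xW yH.
Qed.

Section Flips.
Variables (s W H : nat).
Hypothesis s_ge2 : (2 <= s)%N.
Implicit Types (T : {set tile W H}) (v : vertex W H) (d : bool).

(* [flip_shape i j d r a]: a flip in direction [d] at the vertex [(i, j)]
   removes the square at [r] and creates the one at [a]. *)
Inductive flip_shape (i j : nat) :
    bool -> option (nat * nat) -> option (nat * nat) -> Prop :=
  | Assemble x y of i = (x + s./2)%N & j = (y + s./2)%N :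
      flip_shape i j true None (Some (x, y))
  | Break x y of i = (x + s./2)%N & j = (y + s./2)%N :
      flip_shape i j false (Some (x, y)) None
  | MoveRight x y of i = (x + s)%N & j = (y + s./2)%N :
      flip_shape i j true (Some (x, y)) (Some (x.+1, y))
  | MoveLeft x y of i = x.+1 & j = (y + s./2)%N :
      flip_shape i j false (Some (x.+1, y)) (Some (x, y))
  | MoveUp x y of i = (x + s./2)%N & j = (y + s)%N :
      flip_shape i j true (Some (x, y)) (Some (x, y.+1))
  | MoveDown x y of i = (x + s./2)%N & j = y.+1 :
      flip_shape i j false (Some (x, y.+1)) (Some (x, y)).

(** The kind of flip is visible from which of [r] and [a] are present and from the displacement
    between them; the coordinates then fix the vertex. *)
Lemma flip_shape_inj i j d i' j' d' r a :
  flip_shape i j d r a -> flip_shape i' j' d' r a ->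
  [/\ i = i', j = j' & d = d'].
Proof.
case=> x y -> ->; move eq_r: (X in flip_shape _ _ _ X _) => r';
  move eq_a: (X in flip_shape _ _ _ _ X) => a' sh';
  case: sh' eq_r eq_a => x' y' -> -> //.
all: try by case=> <- <-.
all: try by move=> _ [<- <-].
all: case=> ? ? [? ?]; split; lia.
Qed.

(* When [d] holds, the two unit tiles rule out any other flip at the same
   vertex. *)
Lemma flip_at_shape v d T T' : is_tiling s T -> is_tiling s T' ->
  flip_at s v d T T' ->
  exists r a, [/\ flip_shape v.1 v.2 d r a, change T T' r a,
    d -> has_tile T v.1 v.2 false &
    d -> r = None -> has_tile T v.1.-1 v.2.-1 false].
Proof.
move=> tT tT' /existsP[c /or3P[]] /andP[/andP[/eqP v1 /eqP v2] fl].
- case: d v1 v2 fl => v1 v2 fl.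
    have [ch un] := central_flip_change s_ge2 tT fl.
    exists None, (Some (nat_of_ord c.1, nat_of_ord c.2)).
    by split=> //; [exact: Assemble|move=> _; apply: un; lia|
      move=> _ _; apply: un; lia].
  have [ch _] := central_flip_change s_ge2 tT' (central_flip_rev s_ge2 tT fl).
  exists (Some (nat_of_ord c.1, nat_of_ord c.2)), None.
  by split=> //; [exact: Break|exact: change_rev].
- case: d v1 v2 fl => v1 v2 fl.
    have [ch un] := horizontal_flip_change s_ge2 tT fl.
    exists (Some (nat_of_ord c.1, nat_of_ord c.2)).
    exists (Some (c.1.+1, nat_of_ord c.2)).
    split=> //; first exact: MoveRight.
    by move=> _; rewrite v1; apply: un; lia.
  have [ch _] :=
    horizontal_flip_change s_ge2 tT' (horizontal_flip_rev s_ge2 tT fl).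
  exists (Some (c.1.+1, nat_of_ord c.2)).
  exists (Some (nat_of_ord c.1, nat_of_ord c.2)).
  by split=> //; [apply: MoveLeft; rewrite // v1 addn1|exact: change_rev].
- case: d v1 v2 fl => v1 v2 fl.
    have [ch un] := vertical_flip_change s_ge2 tT fl.
    exists (Some (nat_of_ord c.1, nat_of_ord c.2)).
    exists (Some (nat_of_ord c.1, c.2.+1)).
    split=> //; first exact: MoveUp.
    by move=> _; rewrite v2; apply: un; lia.
  have [ch _] :=
    vertical_flip_change s_ge2 tT' (vertical_flip_rev s_ge2 tT fl).
  exists (Some (nat_of_ord c.1, c.2.+1)).
  exists (Some (nat_of_ord c.1, nat_of_ord c.2)).
  by split=> //; [apply: MoveDown; rewrite // v2 addn1|exact: change_rev].
Qed.

(** Flips of the same kind at one vertex coincide. For different kinds, either the two removed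
    squares would overlap without being equal, or the removed square of a move would cover the unit
    tile at the lower left of the vertex that an assembly requires. *)
Lemma flip_shape_det i j d T T1 T2 r1 a1 r2 a2 : is_tiling s T ->
  flip_shape i j d r1 a1 -> flip_shape i j d r2 a2 ->
  change T T1 r1 a1 -> change T T2 r2 a2 ->
  (d -> r1 = None -> has_tile T i.-1 j.-1 false) ->
  (d -> r2 = None -> has_tile T i.-1 j.-1 false) ->
  r1 = r2 /\ a1 = a2.
Proof.
move=> tT sh1 sh2 [r1T _ _] [r2T _ _].
have sq p q : r1 = Some p -> r2 = Some q ->
    (p.1 < q.1 + s)%N -> (q.1 < p.1 + s)%N ->
    (p.2 < q.2 + s)%N -> (q.2 < p.2 + s)%N -> p.1 = q.1 /\ p.2 = q.2.
  by move=> /r1T Tp /r2T Tq; apply: sq_sq tT Tp Tq.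
have un1 p : r1 = Some p -> has_tile T i.-1 j.-1 false ->
    (p.1 <= i.-1 < p.1 + s)%N -> (p.2 <= j.-1 < p.2 + s)%N -> False.
  by move=> /r1T; apply: sq_unit tT.
have un2 p : r2 = Some p -> has_tile T i.-1 j.-1 false ->
    (p.1 <= i.-1 < p.1 + s)%N -> (p.2 <= j.-1 < p.2 + s)%N -> False.
  by move=> /r2T; apply: sq_unit tT.
have [d2 ed2 {}sh2] : exists2 d2, d = d2 & flip_shape i j d2 r2 a2 by exists d.
move=> {r1T r2T} u1 u2.
case: sh1 sq un1 ed2 u1 u2 => x y ij ij' sq un1 ed2 u1 u2;
  case: sh2 sq un1 un2 ed2 ij ij' u1 u2 =>
    x' y' -> -> sq un1 un2 // _ e e' u1 u2.
all: try by have [-> ->] : x' = x /\ y' = y by lia.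
all: exfalso.
all: try by apply: un1 erefl (u2 isT erefl) _ _ => /=; lia.
all: try by apply: un2 erefl (u1 isT erefl) _ _ => /=; lia.
all: have := sq _ _ erefl erefl; rewrite /=; lia.
Qed.

(** In direction [false] the square to be broken or moved covers the cell [(i, j)], which direction
    [true] requires to be a unit tile. *)
Lemma flip_shape_lazy i j T T2 r2 a2 : is_tiling s T ->
  flip_shape i j false r2 a2 -> change T T2 r2 a2 ->
  has_tile T i j false -> False.
Proof.
move=> tT sh2 [r2T _ _] unT.
have [d2 ed2 {}sh2] : exists2 d2, false = d2 & flip_shape i j d2 r2 a2.
  by exists false.
case: sh2 r2T ed2 unT => x y -> -> r2T // _ unT;
  by apply: sq_unit tT (r2T _ erefl) unT _ _ => /=; lia.
Qed.

(** Hence the choice made by [pick] in [perform_flip] is forced. *)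
Lemma flip_at_fun v d (X Y Z : tiling s W H) :
  flip_at s v d (val X) (val Y) -> flip_at s v d (val X) (val Z) -> Y = Z.
Proof.
move=> /(flip_at_shape (valP X) (valP Y))[r1 [a1 [sh1 ch1 _ u1]]].
move=> /(flip_at_shape (valP X) (valP Z))[r2 [a2 [sh2 ch2 _ u2]]].
have [eq_r eq_a] := flip_shape_det (valP X) sh1 sh2 ch1 ch2 u1 u2.
apply: val_inj; rewrite -eq_r -eq_a in ch2.
exact: change_fun (valP Y) (valP Z) ch1 ch2.
Qed.

Lemma flip_at_pair_inj v d v' d' (X Y : tiling s W H) :
  flip_at s v d (val X) (val Y) -> flip_at s v' d' (val X) (val Y) ->
  (v, d) = (v', d').
Proof.
move=> /(flip_at_shape (valP X) (valP Y))[r1 [a1 [sh1 ch1 _ _]]].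
move=> /(flip_at_shape (valP X) (valP Y))[r2 [a2 [sh2 ch2 _ _]]].
have [eq_r eq_a] := change_inj ch1 ch2; rewrite -eq_r -eq_a in sh2.
have [/val_inj eq1 /val_inj eq2 ->] := flip_shape_inj sh1 sh2.
by rewrite [v]surjective_pairing eq1 eq2 -surjective_pairing.
Qed.

Lemma flip_at_lazy v (X Y Z : tiling s W H) :
  flip_at s v true (val X) (val Y) -> flip_at s v false (val X) (val Z) ->
  False.
Proof.
move=> /(flip_at_shape (valP X) (valP Y))[r1 [a1 [_ _ u _]]].
move=> /(flip_at_shape (valP X) (valP Z))[r2 [a2 [sh2 ch2 _ _]]].
exact: flip_shape_lazy (valP X) sh2 ch2 (u isT).
Qed.

(** The inverse flip uses the same block; for a horizontal or vertical move it is associated to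
    another vertex, which must be shown to be inner. *)
Lemma flip_at_sym v d (X Y : tiling s W H) :
  flip_at s v d (val X) (val Y) ->
  exists2 v', v' \in inner_vertices W H & flip_at s v' (~~ d) (val Y) (val X).
Proof.
move=> /existsP[c /or3P[]] /andP[_ fl].
- have /and3P[xW yH _] := fl.
  have [||v' v'_in at_v'] :=
    @inner_vertexP W H (c.1 + s./2)%N (c.2 + s./2)%N; try lia.
  exists v' => //; apply/existsP; exists c; apply/or3P; apply: Or31.
  by rewrite at_v' !eqxx central_flip_rev // (valP X).
- have /and3P[xW yH _] := fl.
  have [||v' v'_in at_v'] :=
    @inner_vertexP W H (c.1 + (if ~~ d then s else 1))%N (c.2 + s./2)%N.
  + by move: xW {fl}; case: (d) => /=; lia.
  + by lia.
  exists v' => //; apply/existsP; exists c; apply/or3P; apply: Or32.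
  by rewrite at_v' !eqxx horizontal_flip_rev // (valP X).
- have /and3P[xW yH _] := fl.
  have [||v' v'_in at_v'] :=
    @inner_vertexP W H (c.1 + s./2)%N (c.2 + (if ~~ d then s else 1))%N.
  + by lia.
  + by move: yH {fl}; case: (d) => /=; lia.
  exists v' => //; apply/existsP; exists c; apply/or3P; apply: Or33.
  by rewrite at_v' !eqxx vertical_flip_rev // (valP X).
Qed.

(** Since the squares of [Y] are disjoint, no square of [X] meets the one at [c], so its cells are
    unit tiles of [X]. *)
Lemma add_square_flip (X Y : tiling s W H) c :
  c \notin bigs (val X) -> bigs (val Y) = c |: bigs (val X) ->
  central_flip s c.1 c.2 true (val X) (val Y).
Proof.
move=> cX eqY.
have /packingP[inY disjY] := bigs_packing (valP Y).
have cY : c \in bigs (val Y) by rewrite eqY setU11.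
have /andP[xW yH] := inY c cY.
apply/and3P; split=> //; apply/andP; split.
  apply/fintype.subsetP => -[e b]; rewrite inE /= => /andP[ec /negbTE ->].
  rewrite -(fill_bigs (valP X)) inE /=; apply/forall_inP => c' c'X.
  apply/negP => ec'; have c'Y : c' \in bigs (val Y) by rewrite eqY setU1r.
  by move: cX; rewrite (disjY c c' e cY c'Y ec ec') c'X.
have Y_square e : ((e, true) \in val Y) = (e == c) || ((e, true) \in val X).
  by rewrite -mem_bigs eqY finset.in_setU1 mem_bigs.
have Y_unit e : ((e, false) \in val Y) =
    (e \notin square s c) && ((e, false) \in val X).
  have unitE (Z : tiling s W H) : ((e, false) \in val Z) =
      [forall c' in bigs (val Z), e \notin square s c'].
    by rewrite -{1}(fill_bigs (valP Z)) inE.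
  rewrite !unitE eqY; apply/forall_inP/andP => [out|[ec /forall_inP out] c'].
    split; first by apply: out; rewrite setU11.
    by apply/forall_inP => c' c'X; apply: out; rewrite setU1r.
  by rewrite finset.in_setU1 => /orP[/eqP -> //|]; apply: out.
apply/eqP/setP => -[e [|]]; rewrite ?Y_square ?Y_unit !inE ?andbF ?orbF /=.
  rewrite andbT orbC; congr (_ || _); rewrite -!val_eqE.
by case: [&& _, _ & _] => /=; rewrite ?orbF.
Qed.

End Flips.

(** * The Poincare inequality for the flip chain *)

Section Chain.
Variables (R : realType) (s W H : nat).
Hypothesis s_ge2 : (2 <= s)%N.
Implicit Types (X Y : tiling s W H) (v : vertex W H) (d : bool).

Let N := #|inner_vertices W H|.
Let P : tiling s W H -> tiling s W H -> R := @MC_square R s W H.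

Definition flippable X Y :=
  [exists v in inner_vertices W H, exists d, flip_at s v d (val X) (val Y)].

Lemma perform_flip_eq v d X Y : X != Y ->
  (perform_flip v d X == Y) = flip_at s v d (val X) (val Y).
Proof.
move=> neqXY; rewrite /perform_flip; case: pickP => [Z flZ|no_fl] /=.
  by apply/eqP/idP => [<-|flY] //; apply: flip_at_fun flZ flY.
by rewrite (negbTE neqXY) no_fl.
Qed.

Lemma MC_square_neq X Y : X != Y ->
  P X Y = N%:R^-1 * 2^-1 * (flippable X Y)%:R.
Proof.
move=> neqXY; rewrite /P /MC_square -/N.
(* Without inner vertices both sides vanish, the inverse of 0 being 0. *)
have [N0|N_gt0] := eqVneq; first by rewrite (negbTE neqXY) N0 invr0 !mul0r.
rewrite pair_big_dep /=.
under eq_bigr => p _ do rewrite perform_flip_eq //.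
rewrite -mulr_sumr; congr (_ * _).
(* At most one pair of vertex and direction contributes to the sum. *)
have [/exists_inP[v v_in /existsP[d fl]]|no_fl] := boolP (flippable X Y).
  rewrite (bigD1 (v, d)) /= ?v_in // fl big1 ?addr0 // => -[v' d'] /=.
  move=> /andP[_ neq]; case fl': (flip_at _ _ _ _ _) => //.
  by rewrite (flip_at_pair_inj s_ge2 fl' fl) eqxx in neq.
rewrite big1 // => -[v d] /=; rewrite andbT => v_in.
case fl: (flip_at _ _ _ _ _) => //; case/negP: no_fl.
by apply/exists_inP; exists v => //; apply/existsP; exists d.
Qed.

Lemma flippable_sym X Y : flippable X Y = flippable Y X.
Proof.
suff sub (X' Y' : tiling s W H) : flippable X' Y' -> flippable Y' X'.
  by apply/idP/idP; apply: sub.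
move=> /exists_inP[v _ /existsP[d /(flip_at_sym s_ge2)[v' v'_in fl]]].
by apply/exists_inP; exists v' => //; apply/existsP; exists (~~ d).
Qed.

Lemma MC_square_ge0 X Y : 0 <= P X Y.
Proof.
rewrite /P /MC_square; case: ifP => // _.
by do 2![apply: sumr_ge0 => ? _]; rewrite !mulr_ge0 // invr_ge0.
Qed.

Lemma MC_square_sym X Y : P X Y = P Y X.
Proof.
have [->//|neqXY] := eqVneq X Y.
by rewrite (MC_square_neq neqXY) flippable_sym -MC_square_neq // eq_sym.
Qed.

Lemma sum_indicator (I : finType) (i : I) : \sum_j (i == j)%:R = 1 :> R.
Proof.
by rewrite (bigD1 i) //= eqxx big1 ?addr0 // => j; rewrite eq_sym => /negbTE->.
Qed.

Lemma MC_square_sum1 X : \sum_Y P X Y = 1.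
Proof.
rewrite /P /MC_square -/N; case: eqP => [_|/eqP N_neq0].
  exact: sum_indicator.
rewrite exchange_big /=.
transitivity (\sum_(v in inner_vertices W H) N%:R^-1 : R); last first.
  by rewrite sumr_const -/N -[LHS]mulr_natl mulfV // pnatr_eq0.
apply: eq_bigr => v _; rewrite exchange_big /=.
under eq_bigr => d _ do rewrite -mulr_sumr sum_indicator.
by rewrite sumr_const card_bool mulr1 -[LHS]mulr_natl mulrCA mulfV ?mulr1.
Qed.

Lemma MC_square_lazy X : 2^-1 <= P X X.
Proof.
rewrite /P /MC_square -/N; case: eqP => [_|/eqP N_neq0].
  by rewrite eqxx invf_le1 // ler1n.
apply: (@le_trans _ _ (\sum_(v in inner_vertices W H) N%:R^-1 * 2^-1)).
  by rewrite sumr_const -/N -[leRHS]mulr_natl mulrA mulfV ?mul1r // pnatr_eq0.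
apply: ler_sum => v _; rewrite -mulr_sumr big_bool /=.
rewrite -[leLHS]mulr1 ler_wpM2l ?mulr_ge0 ?invr_ge0 //.
have : (perform_flip v true X == X) || (perform_flip v false X == X).
  rewrite /perform_flip; case: pickP => [Y flY|_]; last by rewrite eqxx.
  case: pickP => [Z flZ|_]; last by rewrite eqxx orbT.
  by case: (flip_at_lazy s_ge2 flY flZ).
by case/orP => ->; rewrite ?lerDl ?lerDr.
Qed.

(** Column by column order, shifted by [s * H] so that indices start at the range [B = s * H], as
    the canonical paths require. *)
Definition cell_index (c : cell W H) : nat := ((s + c.1) * H + c.2)%N.

Lemma cell_index_inj : injective cell_index.
Proof.
move=> [c1 c2] [c1' c2']; rewrite /cell_index /= => eq_idx.
have eq2 : nat_of_ord c2 = c2'.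
  have := congr1 (modn^~ H) eq_idx.
  by rewrite /= !modnMDl !modn_small.
have H_gt0 : (0 < H)%N by case: (c2) => i /=; lia.
have : ((s + c1) * H = (s + c1') * H)%N by lia.
move=> /eqP; rewrite eqn_pmul2r // eqn_add2l => /eqP/val_inj ->.
by rewrite (val_inj eq2).
Qed.

Lemma cell_index_bound c : (s * H <= cell_index c < (s + W) * H)%N.
Proof.
have := ltn_ord c.1; have := ltn_ord c.2; rewrite /cell_index => ? ?.
apply/andP; split; first by rewrite mulnDl -addnA leq_addr.
have : ((s + c.1).+1 * H <= (s + W) * H)%N by rewrite leq_mul2r; lia.
by rewrite mulSn; lia.
Qed.

(** Overlapping squares have corners less than [s] columns apart, and each column contributes [H]
    indices. *)
Lemma cell_index_conflict (c c' e : cell W H) :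
  e \in square s c -> e \in square s c' ->
  (cell_index c' < cell_index c + s * H)%N.
Proof.
case: c c' e => [c1 c2] [c1' c2'] [e1 e2].
rewrite !inE /cell_index /= => ec ec'.
have le_c : (c1'.+1 <= s + c1)%N by lia.
have := leq_mul le_c (leqnn H); have := ltn_ord c2'.
rewrite mulSn !mulnDl; lia.
Qed.

Definition code X (i : nat) : bool :=
  [exists c, (i == cell_index c) && (c \in bigs (val X))].

Lemma code_cell X c : code X (cell_index c) = (c \in bigs (val X)).
Proof.
apply/existsP/idP => [[c' /andP[/eqP/cell_index_inj <-]] //|cX].
by exists c; rewrite eqxx.
Qed.

Lemma code_out X i : (forall c, i != cell_index c) -> code X i = false.
Proof.
by move=> out; apply/existsP => -[c /andP[/idP]]; rewrite (negbTE (out c)).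
Qed.

Lemma code_inj X Y : code X =1 code Y -> X = Y.
Proof.
move=> eqXY; apply/val_inj/(bigs_inj (valP X) (valP Y))/setP => c.
by rewrite -!code_cell eqXY.
Qed.

Lemma code_lt X i : code X i -> (s * H <= i < (s + W) * H)%N.
Proof. by move=> /existsP[c /andP[/eqP -> _]]; exact: cell_index_bound. Qed.

Definition mixture X Y (a b : nat) : {set cell W H} :=
  [set c | if (cell_index c < a)%N then c \in bigs (val Y)
           else (b <= cell_index c)%N && (c \in bigs (val X))].

Lemma mem_mixture X Y a b c : (c \in mixture X Y a b) =
  if (cell_index c < a)%N then c \in bigs (val Y)
  else (b <= cell_index c)%N && (c \in bigs (val X)).
Proof. by rewrite inE. Qed.

(** A square kept from [Y] and one kept from [X] are at least [s * H] indices apart, too far to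
    overlap. *)
Lemma mixture_packing X Y a b : (a + s * H <= b)%N ->
  packing s (mixture X Y a b).
Proof.
move=> le_ab.
have /packingP[inX disjX] := bigs_packing (valP X).
have /packingP[inY disjY] := bigs_packing (valP Y).
apply/packingP; split=> [c|c c' e].
  rewrite mem_mixture; case: ifP => _; first exact: inY.
  by move=> /andP[_]; exact: inX.
rewrite !mem_mixture.
case: ifP => [lt_c|_]; case: ifP => [lt_c'|_].
- exact: disjY.
- move=> _ /andP[le_c' _] ec ec'.
  by have := cell_index_conflict ec ec'; lia.
- move=> /andP[le_c _] _ ec ec'.
  by have := cell_index_conflict ec' ec; lia.
- by move=> /andP[_ cX] /andP[_ c'X]; exact: disjX.
Qed.

(** The default [X] is taken only if the filled mixture is not a tiling; a gap of at least [s * H]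
    excludes this. *)
Definition mix X Y a b : tiling s W H := insubd X (fill s (mixture X Y a b)).

Lemma code_mix X Y a b : (a + s * H <= b)%N -> forall i,
  code (mix X Y a b) i = if (i < a)%N then code Y i else (b <= i)%N && code X i.
Proof.
move=> le_ab i.
have val_mix : val (mix X Y a b) = fill s (mixture X Y a b).
  by rewrite val_insubd fill_tiling // mixture_packing.
have [/existsP[c /eqP ->]|] := boolP [exists c, i == cell_index c].
  by rewrite !code_cell val_mix bigs_fill mem_mixture.
rewrite negb_exists => /forallP out.
by rewrite !code_out // andbF if_same.
Qed.

(** The two tilings differ by one large square, so a central flip joins them; its probability is
    [1 / (2 N)], and [N] is at most the number of lattice points. *)
Lemma MC_square_single X Y i :
  (forall j, j != i -> code X j = code Y j) -> X != Y ->
  (2 * (W.+1 * H.+1))%:R^-1 <= P X Y.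
Proof.
move=> eqXY neqXY.
suff flip : flippable X Y.
  rewrite MC_square_neq // flip mulr1 -invfM mulrC -natrM.
  have N_gt0 : (0 < N)%N.
    by case/exists_inP: flip => v v_in _; apply/card_gt0P; exists v.
  rewrite lef_pV2 ?posrE ?ltr0n ?muln_gt0 // ler_nat leq_pmul2l //.
  by rewrite (leq_trans (max_card _)) // card_prod !card_ord.
have [c cXY] : exists c, (c \in bigs (val X)) != (c \in bigs (val Y)).
  apply/existsP; apply: contraNT neqXY; rewrite negb_exists => /forallP eq_c.
  apply/eqP/val_inj/(bigs_inj (valP X) (valP Y))/setP => c.
  by have := eq_c c; rewrite negbK => /eqP.
have idx_c : cell_index c = i.
  by apply: contraNeq cXY => neq; rewrite -!code_cell eqXY.
have eq_out c' : c' != c -> (c' \in bigs (val X)) = (c' \in bigs (val Y)).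
  move=> neq; rewrite -!code_cell eqXY // -idx_c.
  by apply: contraNneq neq => /cell_index_inj ->.
have add (X' Y' : tiling s W H) : c \notin bigs (val X') ->
    c \in bigs (val Y') ->
    (forall c', c' != c -> (c' \in bigs (val X')) = (c' \in bigs (val Y'))) ->
    flippable X' Y'.
  move=> cX' cY' eq_out'.
  have eqY' : bigs (val Y') = c |: bigs (val X').
    apply/setP => c'; rewrite finset.in_setU1.
    by have [->|/eq_out'] := eqVneq c' c.
  have fl := add_square_flip cX' eqY'.
  have /and3P[xW yH _] := fl.
  have [||v v_in at_v] := @inner_vertexP W H (c.1 + s./2)%N (c.2 + s./2)%N.
  - lia.
  - lia.
  apply/exists_inP; exists v => //; apply/existsP; exists true.
  by apply/existsP; exists c; rewrite /= at_v !eqxx fl.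
case cX: (c \in bigs (val X)) cXY; case cY: (c \in bigs (val Y)) => // _.
  by rewrite flippable_sym; apply: add; rewrite ?cX ?cY // => c' /eq_out.
by apply: add; rewrite ?cX ?cY.
Qed.

Lemma card_tiling : (#|tiling s W H| <= 2 ^ (2 * (W * H)))%N.
Proof.
rewrite card_sig (leq_trans (max_card _)) //.
rewrite -cardsT -powersetT card_powerset cardsT.
by rewrite !card_prod !card_ord card_bool mulnC.
Qed.

(** Twice the constant of [path_poincare] for [L = (s + W) * H], [B = s * H] and
    [K = 2 * (W.+1 * H.+1)], plus 1 to make it positive. *)
Definition relaxation_bound : nat :=
  (16 * ((s + W) * H) ^ 2 * 4 ^ (s * H).+1 * (W.+1 * H.+1)).+1.

Lemma MC_square_mixing_time :
  (mixing_time P (@uniform_dist R (tiling s W H)) <=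
   ((relaxation_bound * (2 * (W * H) + 2))%:R)%:E)%E.
Proof.
apply: mixing_time_le => //.
- exact: MC_square_ge0.
- exact: MC_square_sum1.
- exact: MC_square_sym.
- exact: MC_square_lazy.
- move=> f; apply: le_trans (path_poincare code_inj code_lt code_mix
    MC_square_ge0 _ MC_square_single f) _; first by [].
  have dir_ge0 : 0 <= dirichlet P f.
    apply: sumr_ge0 => X _; apply: sumr_ge0 => Y _.
    by rewrite mulr_ge0 ?sqr_ge0 ?MC_square_ge0.
  have const_le (a b k : nat) : 4 * a%:R ^+ 2 * b%:R * (2 * k)%:R <=
      2^-1 * (16 * a ^ 2 * b * k).+1%:R :> R.
    rewrite -(natr1 (16 * a ^ 2 * b * k)) !(natrM _ _ k) (natrM _ _ b).
    rewrite (natrM _ 16 (a ^ 2)%N) natrX.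
    lra.
  by rewrite ler_wpM2r // ler_wpM2r // const_le.
(* A tiling is a subset of the [2 * (W * H)] tiles; the additional 2 in the exponent accounts for
   the factor 4. *)
by rewrite addnC expnD leq_mul2l card_tiling orbT.
Qed.

End Chain.

(** * Polynomial bounds *)

Lemma expr_log_floor_le (R : realType) (b : R) (n : nat) : 1 < b -> (0 < n)%N ->
  b ^+ log_floor b n <= n%:R.
Proof.
move=> b_gt1 n_gt0; have b_gt0 : 0 < b by apply: lt_trans b_gt1.
have n_gt0R : 0 < n%:R :> R by rewrite ltr0n.
rewrite -ler_ln ?posrE ?exprn_gt0 // lnXn // -[ln b *+ _]mulr_natl.
rewrite -ler_pdivlMr ?ln_gt0 // /log_floor truncn_le //.
by rewrite divr_ge0 ?ln_ge0 ?ler1n ?ltW.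
Qed.

(** With [2 <= b ^ q], the left side is at most [(b ^ log_floor b n) ^ q]. *)
Lemma exp2_log_floor_le (R : realType) (b : R) : 1 < b ->
  exists q, forall n, (0 < n)%N -> (2 ^ log_floor b n <= n ^ q)%N.
Proof.
move=> b_gt1.
have [q b_q] : exists q, 2 <= b ^+ q.
  have bern k : 1 + k%:R * (b - 1) <= b ^+ k.
    elim: k => [|k IHk]; first by rewrite mul0r addr0 expr0.
    rewrite exprSr; apply: le_trans (ler_wpM2r _ IHk); first last.
      by rewrite ltW // (lt_trans _ b_gt1).
    have := mulr_ge0 (ler0n R k) (sqr_ge0 (b - 1)).
    rewrite -(natr1 k); nra.
  (* This exponent makes [q * (b - 1)] at least 1 in Bernoulli's inequality. *)
  exists (Num.bound (b - 1)^-1); apply: le_trans (bern _).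
  have b1_gt0 : 0 < b - 1 by rewrite subr_gt0.
  have /ltW : (b - 1)^-1 < (Num.bound (b - 1)^-1)%:R.
    by apply: archi_boundP; rewrite invr_ge0 ltW.
  by rewrite -[_^-1]mul1r ler_pdivrMr // => ?; lra.
exists q => n n_gt0; rewrite -(ler_nat R) !natrX.
apply: le_trans (_ : b ^+ q ^+ log_floor b n <= _).
  by rewrite lerXn2r ?nnegrE // exprn_ge0 //; lra.
rewrite -exprM mulnC exprM lerXn2r ?nnegrE ?exprn_ge0 ?expr_log_floor_le //.
lra.
Qed.

Definition polynomially_bounded (u : nat -> nat) :=
  exists C k, forall n, (0 < n)%N -> (u n <= C * n ^ k)%N.

Lemma polynomially_bounded_le (u w : nat -> nat) :
  (forall n, (0 < n)%N -> (u n <= w n)%N) -> polynomially_bounded w ->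
  polynomially_bounded u.
Proof.
move=> le_uw [C [k le_w]]; exists C, k => n n_gt0.
exact: leq_trans (le_uw n n_gt0) (le_w n n_gt0).
Qed.

Lemma polynomially_bounded_const c : polynomially_bounded (fun=> c).
Proof. by exists c, 0%N => n _; rewrite expn0 muln1. Qed.

Lemma polynomially_bounded_id : polynomially_bounded id.
Proof. by exists 1%N, 1%N => n _; rewrite mul1n. Qed.

Lemma polynomially_boundedD u w : polynomially_bounded u ->
  polynomially_bounded w -> polynomially_bounded (fun n => u n + w n)%N.
Proof.
move=> [C [k le_u]] [C' [k' le_w]]; exists (C + C')%N, (k + k')%N => n n_gt0.
rewrite mulnDl leq_add // ?(leq_trans (le_u n n_gt0)) //.
  by rewrite leq_mul2l leq_pexp2l ?orbT // leq_addr.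
by rewrite (leq_trans (le_w n n_gt0)) // leq_mul2l leq_pexp2l ?orbT // leq_addl.
Qed.

Lemma polynomially_boundedM u w : polynomially_bounded u ->
  polynomially_bounded w -> polynomially_bounded (fun n => u n * w n)%N.
Proof.
move=> [C [k le_u]] [C' [k' le_w]]; exists (C * C')%N, (k + k')%N => n n_gt0.
by rewrite expnD mulnACA leq_mul ?le_u ?le_w.
Qed.

Lemma polynomially_boundedX u e : polynomially_bounded u ->
  polynomially_bounded (fun n => u n ^ e)%N.
Proof.
move=> bd_u; elim: e => [|e IHe]; first exact: polynomially_bounded_const.
apply: polynomially_bounded_le (polynomially_boundedM bd_u IHe) => n _.
by rewrite expnS.
Qed.

Theorem theorem3 (R : realType) (s : nat) (hs : (2 <= s)%N) (b : R) (hb : 1 < b) :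
  exists p : {poly R}, forall n : nat, (0 < n)%N ->
    (mixing_time (@MC_square R s n (log_floor b n))
                 (@uniform_dist R (tiling s n (log_floor b n)))
     <= (p.[n%:R])%:E)%E.
Proof.
pose h n := log_floor b n.
have [q le_q] := exp2_log_floor_le hb.
have bd_2h : polynomially_bounded (fun n => 2 ^ h n)%N.
  by exists 1%N, q => n n_gt0; rewrite mul1n le_q.
have bd_h : polynomially_bounded h.
  apply: polynomially_bounded_le bd_2h => n _; exact/ltnW/ltn_expl.
(* The exponential congestion factor is polynomial because the height is logarithmic and [s] is
   fixed. *)
have bd_4sh : polynomially_bounded (fun n => 4 ^ (s * h n).+1)%N.
  apply: (@polynomially_bounded_le _ (fun n => 4 * (2 ^ h n) ^ (2 * s))%N).
    move=> n _; rewrite expnS leq_mul2l -expnM -[4%N]/(2 ^ 2)%N -expnM.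
    by rewrite leq_exp2l //; lia.
  apply: polynomially_boundedM; first exact: polynomially_bounded_const.
  exact: polynomially_boundedX.
have bd_S u : polynomially_bounded u ->
    polynomially_bounded (fun n => (u n).+1).
  move=> bd_u; apply: polynomially_bounded_le
    (polynomially_boundedD bd_u (polynomially_bounded_const 1)) => n _.
  by rewrite addn1.
have [C [k le_C]] : polynomially_bounded (fun n =>
    relaxation_bound s n (h n) * (2 * (n * h n) + 2))%N.
  apply: polynomially_boundedM.
    apply: (bd_S).
    apply: polynomially_boundedM.
      apply: polynomially_boundedM => //.
      apply: polynomially_boundedM; first exact: polynomially_bounded_const.
      apply/polynomially_boundedX/polynomially_boundedM => //.
      apply: polynomially_boundedD; first exact: polynomially_bounded_const.
      exact: polynomially_bounded_id.
    apply: polynomially_boundedM; last exact: bd_S.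
    exact/bd_S/polynomially_bounded_id.
  apply: polynomially_boundedD; last exact: polynomially_bounded_const.
  apply: polynomially_boundedM; first exact: polynomially_bounded_const.
  by apply: polynomially_boundedM => //; exact: polynomially_bounded_id.
exists (C%:R *: 'X^k) => n n_gt0.
apply: le_trans (MC_square_mixing_time R n (log_floor b n) hs) _.
by rewrite lee_fin hornerZ hornerXn -natrX -natrM ler_nat le_C.
Qed.
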